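(* For every real $\delta < 2$ and every constant positive integer $\ell$, we have $\alpha_{\star}(\delta,\ell) < 2$.
   Context: All logarithms are in base $2$. $G_{n,\frac12}$ denotes the random graph on vertex set $V=\{1,\dots,n\}$ in which each of the $\binom n2$ pairs of vertices is an edge independently with probability $\frac12$. Probe model with $\ell$ rounds. An algorithm has unbounded computation time and accesses the input graph $G$ only by probes; a probe of a pair $(i,j)$, $1\le i<j\le n$, reveals whether $(i,j)$ is an edge of $G$. The algorithm proceeds in $\ell$ rounds: in round $1$ it selects a set $E_1$ of pairs and the status (edge or non-edge) of all pairs in $E_1$ is revealed; for $2 \le i\le \ell$, in round $i$ it selects a set $E_i$ of pairs, depending on the outcomes of the probes in rounds $1,\dots,i-1$, and the status of all pairs in $E_i$ is revealed. All probes of one round are done in parallel. After round $\ell$ the algorithm outputs a set of vertices, which it has to ensure is a clique of $G$. The total number of probes is $\sum_{i=1}^{\ell}|E_i|$. $\alpha_{\star}(\delta,\ell)$ is the supremum over all $\alpha$ such that there exists an algorithm (one for each $n$) that, on a graph drawn at random from $G_{n,\frac12}$, probes at most $n^{\delta}$ entries of the adjacency matrix, with the probes being done in $\ell$ rounds, and outputs a clique of size at least $\alpha\log n$ with probability at least $\frac12$, for all sufficiently large $n$. *)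

(* Defs.v *)
From HB Require Import structures.
From mathcomp Require Import all_boot all_order all_algebra.
From mathcomp Require Import all_classical all_reals all_analysis.

Set Implicit Arguments.
Unset Strict Implicit.
Unset Printing Implicit Defensive.

Import Order.TTheory GRing.Theory Num.Theory.

Local Open Scope classical_set_scope.
Local Open Scope ring_scope.

(** The vertices 1, ..., n are represented by ['I_n]. A graph on them is its
    set of edges, each unordered pair being written once, smaller end first. *)
Definition vpair (n : nat) : finType := {e : 'I_n * 'I_n | (e.1 < e.2)%N}.

Definition graph (n : nat) : finType := {set vpair n}.

Definition clique n (G : graph n) (C : {set 'I_n}) : bool :=
  [forall e : vpair n,
    ((val e).1 \in C) && ((val e).2 \in C) ==> (e \in G)].

(** Probability of drawing [G] from G(n,p). *)
Definition gnp (R : realType) (n : nat) (p : R) (G : graph n) : R :=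
  \prod_(e : vpair n) (if e \in G then p else 1 - p).

Definition gnp_prob (R : realType) (n : nat) (p : R) (A : {set graph n}) : R :=
  \sum_(G in A) gnp p G.

Lemma gnp_prob_setT (R : realType) (n : nat) (p : R) :
  gnp_prob p [set: graph n]%SET = 1.
Proof.
rewrite /gnp_prob /gnp (eq_bigl (mem [set: graph n]%SET)) //.
transitivity (\prod_(e : vpair n) (p + (1 - p))).
  rewrite bigA_distr; apply: eq_big => [G|G _] //.
  by rewrite !inE.
by rewrite big1 // => e _; rewrite addrC subrK.
Qed.

(** What has been revealed in the rounds played so far, oldest round first:
    for each round, the probed pairs and those of them that are edges. *)
Definition history (n : nat) : Type :=
  seq ({set vpair n} * {set vpair n}).

(** An algorithm is a pair of arbitrary functions of the history; the number of
    the current round is the size of the history. *)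
Record algorithm (n : nat) : Type := Algorithm {
  select : history n -> {set vpair n};
  output : history n -> {set 'I_n}
}.

Fixpoint run n (A : algorithm n) (G : graph n) (i : nat) : history n :=
  if i is j.+1 then
    let h := run A G j in
    rcons h (select A h, select A h :&: G)%SET
  else [::].

Definition num_probes n (A : algorithm n) (l : nat) (G : graph n) : nat :=
  (\sum_(i < l) #|select A (run A G i)|)%N.

Definition answer n (A : algorithm n) (l : nat) (G : graph n) : {set 'I_n} :=
  output A (run A G l).

Definition log2 (R : realType) (x : R) : R := ln x / ln 2.

(** The last condition bounds only the size of the answer, since the answer is
    required to be a clique on every input graph. *)
Definition achievable (R : realType) (delta : R) (l : nat) : set R :=
  [set alpha : R | exists A : forall n, algorithm n, \forall n \near \oo,
    [/\ forall G : graph n, (num_probes (A n) l G)%:R <= n%:R `^ delta,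
        forall G : graph n, clique G (answer (A n) l G)
      & 2^-1 <= gnp_prob (2^-1 : R)
          [set G : graph n |
            alpha * log2 n%:R <= #|answer (A n) l G|%:R :> R]%SET ] ].

Definition alpha_star (R : realType) (delta : R) (l : nat) : \bar R :=
  ereal_sup [set alpha%:E | alpha in achievable delta l].

(* Main.v *)
Require Import Defs.
From mathcomp Require Import all_boot all_order all_algebra.
From mathcomp Require Import all_classical all_reals all_analysis.
From mathcomp Require Import unstable fintype finset zify ring lra.

Set Implicit Arguments.
Unset Strict Implicit.
Unset Printing Implicit Defensive.

Import Order.TTheory GRing.Theory Num.Theory.

(** Put k = (2 - eps) log n. A set of vertices that the algorithm can certify
    to be a clique has all its pairs probed: otherwise deleting an unprobed edge
    would leave the run, hence the answer, unchanged and falsify it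
    ([pairs_answer_probed]). So it suffices to bound the probability that some
    k-clique C has all its pairs probed.

    Let F_i be the set of pairs probed in the first i rounds, at most n^delta
    of them. The proof combines two opposite effects.

    - If F_(i+1) contains m disjoint pairs of C, then C can be specified by m
      elements of F_(i+1) and k - 2m vertices. This leaves only
      n^(delta m + k - 2m) candidates, a gain of n^((2 - delta) m) over the
      trivial count n^k ([card_matched_sets]).
    - If F_i contains at most q pairs of C, then, given the outcomes of the
      first i rounds, which determine F_(i+1) and the list of candidates, at
      least 'C(k, 2) - q pairs of C are still independent fair coins, so that C
      is a clique with probability at most 2^(q - 'C(k, 2))
      ([card_exists_superset_adaptive]).

    A set of pairs inside C either contains m disjoint pairs or, its pairs
    all meeting a maximal family of fewer disjoint ones, has at most 2mk
    elements ([matching_or_sparse]). Fix thresholds m_i = c_i k for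
    0 <= i <= l, with c_0 < ... < c_l = 1/8. The bound
    |F_i inside C| <= 2 m_i k holds for i = 0, as F_0 is empty, and fails for
    i = l, as F_l contains all pairs of C. So it holds at some i and fails at
    i + 1, and both effects apply, with q = 2 m_i k and m = m_(i+1)
    ([card_large_answer]). A union bound over the l values of i remains. The
    logarithm of its i-th term is about
      k log n (eps / 2 - (2 - delta) c_(i+1) + 4 c_i),
    which tends to minus infinity when c_i is a small multiple of
    (2 - delta) c_(i+1) and eps a small multiple of (2 - delta) c_1
    ([round_exponent_le]). As the number of rounds is fixed, eps does not
    depend on n ([large_cliques_rare]). *)

Local Open Scope nat_scope.
Local Open Scope set_scope.

(** * Random sets revealed adaptively *)

(** Here a uniformly random subset [G] of [T] is examined adaptively: [Phi G]
    is the part of [T] examined before the decision [P], so that [P] depends on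
    [G] only through its trace on [Phi G]. Given that trace, the points of [S]
    outside [Phi G] are independent fair coins. In counting form: deleting from
    [G] an arbitrary set of points of [S] not yet examined preserves [P], and
    this operation is injective, because [G] contains [S] and so is recovered
    by adding [S] back. *)
Lemma card_superset_adaptive (T : finType) (P : pred {set T})
    (Phi : {set T} -> {set T}) (S : {set T}) (s : nat) :
  (forall G G' : {set T}, G' :&: Phi G = G :&: Phi G -> P G -> P G') ->
  #|[set G | [&& P G, S \subset G & s <= #|S :\: Phi G|]]| * 2 ^ s
    <= #|[set G | P G]|.
Proof.
move=> PPhi; set B := [set G | _].
pose X := [set p : {set T} * {set T} |
  (p.1 \in B) && (p.2 \subset S :\: Phi p.1)].
have cardX : #|X| = \sum_(G in B) 2 ^ #|S :\: Phi G|.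
  under eq_bigr do rewrite -card_powerset -sum1_card.
  by rewrite pair_big_dep -sum1_card; apply: eq_bigl => p; rewrite !inE.
apply: (@leq_trans #|X|).
  rewrite cardX -sum_nat_const; apply: leq_sum => G.
  by rewrite inE => /and3P[_ _ sG]; rewrite leq_pexp2l.
(* [G :\: Y] determines [G], by adding [S], and then [Y], as a difference. *)
have injX : {in X &, injective (fun p : {set T} * {set T} => p.1 :\: p.2)}.
  have recover (p : {set T} * {set T}) : p \in X ->
      p = ((p.1 :\: p.2) :|: S, ((p.1 :\: p.2) :|: S) :\: (p.1 :\: p.2)).
    case: p => G Y; rewrite !inE /= => /andP[/and3P[_ SG _]].
    rewrite subsetD => /andP[YS _].
    have GE : G :\: Y :|: S = G.
      apply/setP => e; rewrite !inE.
      move/implyP: (subsetP SG e); move/implyP: (subsetP YS e).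
      by case: (e \in Y); case: (e \in S); case: (e \in G).
    rewrite GE; congr pair; apply/setP => e; rewrite !inE.
    move/implyP: (subsetP SG e); move/implyP: (subsetP YS e).
    by case: (e \in Y); case: (e \in S); case: (e \in G).
  by move=> p q pX qX /= pq; rewrite (recover p pX) (recover q qX) pq.
rewrite -(card_in_imset injX); apply/subset_leq_card/subsetP => G'.
case/imsetP => -[G Y]; rewrite !inE /= => /andP[/and3P[PG _ _]].
rewrite subsetD => /andP[_ dY] ->; apply: PPhi PG.
apply/setP => e; rewrite !inE; case: (boolP (e \in Y)) => //= eY.
by rewrite (disjointFr dY eY) !andbF.
Qed.

(** A union bound in which the list [cand G] of events is itself chosen
    adaptively. Only the size of the list counts, and not the total number of
    events that can occur in it, because the previous lemma compares with the
    number of [G] that list [C], and these numbers add up to the sum over [G]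
    of the sizes of the lists. *)
Lemma card_exists_superset_adaptive (T I : finType)
    (cand : {set T} -> {set I}) (Phi : {set T} -> {set T})
    (S : I -> {set T}) (s D : nat) :
  (forall G G' : {set T}, G' :&: Phi G = G :&: Phi G -> cand G' = cand G) ->
  (forall G, #|cand G| <= D) ->
  #|[set G | [exists C in cand G,
        (S C \subset G) && (s <= #|S C :\: Phi G|)]]| * 2 ^ s
    <= D * 2 ^ #|T|.
Proof.
move=> candPhi candD; set B := [set G | _].
pose BC C := [set G | [&& C \in cand G, S C \subset G & s <= #|S C :\: Phi G|]].
have BU : B \subset \bigcup_C BC C.
  apply/subsetP => G; rewrite inE => /existsP[C CG].
  by apply/bigcupP; exists C; rewrite // inE.
apply: (@leq_trans (\sum_C #|[set G | C \in cand G]|)).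
  apply: (@leq_trans (\sum_C #|BC C| * 2 ^ s)).
    rewrite -big_distrl leq_mul2r (leq_trans (subset_leq_card BU)) ?orbT //.
    exact: card_big_setU.
  apply: leq_sum => C _; apply: card_superset_adaptive => G G' /candPhi ->.
  by [].
have -> : \sum_C #|[set G | C \in cand G]| = \sum_(G : {set T}) #|cand G|.
  under eq_bigr do rewrite -sum1dep_card big_mkcond /=.
  rewrite exchange_big /=; apply: eq_bigr => G _.
  by rewrite -big_mkcond sum1_card.
apply: (@leq_trans (\sum_(G : {set T}) D)); first exact: leq_sum.
have := card_powerset [set: T].
by rewrite powersetT sum_nat_const !cardsT => ->; rewrite mulnC.
Qed.

(** * Pairs inside a set of vertices *)

Lemma bin_leq_exp a r : 'C(a, r) <= a ^ r.
Proof.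
elim: r a => [|r IHr] [|a] //.
have := mul_bin_diag a.+1 r; rewrite /= => h.
rewrite -(@leq_pmul2l r.+1) // -h expnS mulnCA.
apply: (@leq_trans (a.+1 * a ^ r)); first by rewrite leq_mul2l IHr orbT.
rewrite leq_mul2l; apply/orP; right.
apply: (@leq_trans (a.+1 ^ r)); last by rewrite leq_pmull.
by case: (r) => // r'; rewrite leq_exp2r.
Qed.

Section Pairs.
Variable n : nat.
Implicit Types (C W : {set 'I_n}) (Q F : {set vpair n}) (s : seq (vpair n)).

Definition pairs C : {set vpair n} :=
  [set e | ((val e).1 \in C) && ((val e).2 \in C)].

Lemma clique_pairs (G : graph n) C : clique G C = (pairs C \subset G).
Proof.
apply/forallP/subsetP => [h e|h e].
  by rewrite inE; apply/implyP.
by apply/implyP => eC; apply: h; rewrite inE.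
Qed.

Lemma card_pairs C : 'C(#|C|, 2) <= #|pairs C|.
Proof.
rewrite -cards_draws.
apply: leq_trans (leq_imset_card (fun e => [set (val e).1; (val e).2]) _).
apply/subset_leq_card/subsetP => D; rewrite inE => /andP[DC /cards2P[x [y]]].
have sub (x' y' : 'I_n) : x' < y' -> D = [set x'; y'] ->
    D \in [set [set (val e).1; (val e).2] | e in pairs C].
  move=> xy DE; apply/imsetP; exists (exist _ (x', y') xy : vpair n) => //.
  by rewrite inE /=; apply/andP; split; apply: (subsetP DC); rewrite DE !inE
    eqxx ?orbT.
case=> xNy DE; case: (ltngtP x y) => [xy|yx|/val_inj xy].
- exact: sub xy DE.
- by apply: (sub _ _ yx); rewrite DE setUC.
- by rewrite xy eqxx in xNy.
Qed.

Definition ends s : {set 'I_n} :=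
  \bigcup_(e <- s) [set (val e).1; (val e).2].

Lemma card_pairs_meeting C W Q :
  Q \subset pairs C ->
  (forall e, e \in Q -> ((val e).1 \in W) || ((val e).2 \in W)) ->
  #|Q| <= #|W| * #|C|.
Proof.
move=> QC QW; rewrite -cardsX.
(* Listing first an endpoint lying in [W] is injective, since the order of the
   two ends of a pair can be restored. *)
pose g (e : vpair n) :=
  if (val e).1 \in W then val e else ((val e).2, (val e).1).
have gI : injective g.
  move=> e f; rewrite /g => efE; apply: val_inj.
  have := valP e; have := valP f; move: efE.
  case: (val e) => a b; case: (val f) => c d /=.
  by case: ifP => _; case: ifP => _ // [-> ->] // h1 h2;
    have := ltn_trans h1 h2; rewrite ltnn.
rewrite -(card_imset _ gI); apply/subset_leq_card/subsetP => p.
case/imsetP => e eQ ->.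
have := subsetP QC e eQ; rewrite inE => /andP[e1 e2].
by rewrite inE /g; have := QW e eQ; case: ifP => /= [->|_ ->];
  rewrite ?e1 ?e2.
Qed.

(** The graph-theoretic dichotomy between a large matching and a small vertex
    cover: that the pairs in [s] are disjoint is expressed by the number of
    their ends. When a matching cannot be extended, all pairs of [Q] meet
    the set of its ends, so that few pairs are possible. *)
Lemma matching_or_sparse C Q m : Q \subset pairs C ->
  (exists s, [/\ size s = m, {subset s <= Q} & #|ends s| = 2 * m])
  \/ #|Q| <= 2 * m * #|C|.
Proof.
move=> QC; elim: m => [|m [[s [sm sQ cs]]|sparse]].
- by left; exists [::]; rewrite /ends big_nil cards0.
- have [/existsP[e /and3P[eQ e1 e2]]|no] := boolP [exists e in Q,
      ((val e).1 \notin ends s) && ((val e).2 \notin ends s)].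
    left; exists (e :: s); split; first by rewrite /= sm.
      by move=> f; rewrite in_cons => /orP[/eqP ->|/sQ].
    rewrite /ends big_cons cardsU -/(ends s) cs cards2.
    have -> : [set (val e).1; (val e).2] :&: ends s = set0.
      apply/setP => x; rewrite !inE; apply/negP => /andP[].
      by case/orP => /eqP -> => [/(negP e1)|/(negP e2)].
    have -> : (val e).1 != (val e).2.
      by apply/eqP => eE; have := valP e; rewrite eE ltnn.
    by rewrite cards0; lia.
  right; apply: (@leq_trans (#|ends s| * #|C|)); last first.
    by rewrite cs leq_mul2r leq_mul2l leqnSn !orbT.
  apply: card_pairs_meeting => // e eQ; apply: contraNT no.
  by rewrite negb_or => /andP[e1 e2]; apply/existsP; exists e;
    rewrite eQ e1 e2.
- by right; apply: leq_trans sparse _; rewrite leq_mul2r leq_mul2l leqnSn !orbT.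
Qed.

(** The k-sets that contain a matching of [m] pairs taken from [F]. The
    matching is a finite function, rather than a sequence, to make the choices
    of a matching easy to count. *)
Definition matched_sets k m F : {set {set 'I_n}} :=
  [set C : {set 'I_n} | (#|C| == k) && [exists s : {ffun 'I_m -> vpair n},
     [&& s \in ffun_on (mem F), #|ends (codom s)| == 2 * m
       & ends (codom s) \subset C]]].

(** Such a set is determined by its matching and its other [k - 2 * m]
    elements; each pair of the matching has at most [M] values instead of the
    [n ^ 2] values of two free vertices. *)
Lemma card_matched_sets k m F M :
  #|F| <= M -> #|matched_sets k m F| <= M ^ m * n ^ (k - 2 * m).
Proof.
move=> FM.
pose X := setX [set s : {ffun 'I_m -> vpair n} | s \in ffun_on (mem F)]
  [set D : {set 'I_n} | #|D| == k - 2 * m].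
apply: (@leq_trans #|X|); last first.
  rewrite cardsX card_draws card_ord leq_mul ?bin_leq_exp //.
  rewrite cardsE card_ffun_on card_ord.
  by case: (m) => // m'; rewrite leq_exp2r.
pose join (p : {ffun 'I_m -> vpair n} * {set 'I_n}) := ends (codom p.1) :|: p.2.
apply: leq_trans (leq_imset_card join _).
apply/subset_leq_card/subsetP => C; rewrite inE => /andP[/eqP Ck].
case/existsP => s /and3P[sF /eqP sm sC].
apply/imsetP; exists (s, C :\: ends (codom s)); last first.
  apply/setP => x; rewrite !inE /=.
  by have := subsetP sC x; case: (x \in ends _) => // ->.
by rewrite in_setX !in_set sF /= cardsD (setIidPr sC) sm Ck.
Qed.

Lemma matched_setsP k m F C s : #|C| = k -> size s = m ->
  {subset s <= F :&: pairs C} -> #|ends s| = 2 * m -> C \in matched_sets k m F.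
Proof.
move=> Ck sm sQ cs; subst m.
rewrite inE Ck eqxx /=; apply/existsP; exists [ffun i => tnth (in_tuple s) i].
have codE : ends (codom [ffun i => tnth (in_tuple s) i]) = ends s.
  congr ends; rewrite -[RHS](map_tnth_enum (in_tuple s)) /codom.
  by apply: eq_map => i; rewrite ffunE.
rewrite codE cs eqxx /=; apply/andP; split.
  by apply/ffun_onP => i; rewrite ffunE; have := sQ _ (mem_tnth i (in_tuple s));
    rewrite inE => /andP[].
rewrite /ends; elim: (s) sQ => [|e s' IH] sQ; first by rewrite big_nil sub0set.
rewrite big_cons subUset; apply/andP; split; last first.
  by apply: IH => f fs; apply: sQ; rewrite in_cons fs orbT.
have := sQ e (mem_head _ _); rewrite !inE => /and3P[_ e1 e2].
by apply/subsetP => x; rewrite !inE => /orP[] /eqP ->.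
Qed.

End Pairs.

(** * Probing in rounds *)

Lemma exists_crossing (P : pred nat) l :
  P 0 -> ~~ P l -> exists2 i, i < l & P i && ~~ P i.+1.
Proof.
move=> P0; elim: l => [|l IHl]; first by rewrite P0.
case: (boolP (P l)) => [Pl Pl1|/IHl[i il Pi] _]; last by exists i => //; lia.
by exists l; rewrite // Pl.
Qed.

Section Rounds.
Variables (n : nat) (A : algorithm n).
Implicit Types G : graph n.

Definition probed (i : nat) G : {set vpair n} :=
  \bigcup_(j < i) select A (run A G j).

Lemma probedS i G : probed i.+1 G = probed i G :|: select A (run A G i).
Proof. by rewrite /probed big_ord_recr. Qed.

(** The first [i] rounds depend on the graph only through the pairs that they
    probe, so they form an adaptive examination of a random set. *)
Lemma run_eq_probed i G G' :
  G' :&: probed i G = G :&: probed i G ->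
  forall j, j <= i -> run A G' j = run A G j.
Proof.
move=> agree; elim=> //= j IHj ji; rewrite IHj; last exact: ltnW.
congr (rcons _ (_, _)); apply/setP => e; rewrite !inE.
case: (boolP (e \in select A (run A G j))) => //= eS.
have eP : e \in probed i G by apply/bigcupP; exists (Ordinal ji).
by move/setP/(_ e): agree; rewrite !inE eP !andbT.
Qed.

(** The selection of a round precedes its answers: the pairs probed in round
    [i.+1] are already determined by the outcomes of the first [i] rounds. *)
Lemma probedS_eq i G G' :
  G' :&: probed i G = G :&: probed i G -> probed i.+1 G' = probed i.+1 G.
Proof.
move=> agree; apply: eq_bigr => j _.
by rewrite (run_eq_probed agree) // -ltnS.
Qed.

Lemma card_probed l i G : i <= l -> #|probed i G| <= num_probes A l G.
Proof.
move=> il; apply: leq_trans (card_big_setU _ _ _) _.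
rewrite /num_probes (big_ord_widen l (fun j => #|select A (run A G j)|) il).
by rewrite [X in _ <= X](bigID (fun j : 'I_l => j < i)) leq_addr.
Qed.

(** An answer that is a clique whatever the input can only rely on probed pairs:
    removing an unprobed edge would not change it. *)
Lemma pairs_answer_probed l :
  (forall G, clique G (answer A l G)) ->
  forall G, pairs (answer A l G) \subset probed l G.
Proof.
move=> cl G; apply/subsetP => e eA; apply/negPn/negP => eP.
have agree : (G :\ e) :&: probed l G = G :&: probed l G.
  apply/setP => f; rewrite !inE; case: (eqVneq f e) => [->|_] //=.
  by rewrite (negbTE eP) !andbF.
have := cl (G :\ e : graph n).
rewrite /answer (run_eq_probed agree) // clique_pairs.
by move/subsetP/(_ e eA); rewrite !inE eqxx.
Qed.

(** The union bound over the rounds, for arbitrary thresholds [m]: [i] is a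
    round at which the probes inside the clique pass from at most
    [2 * m i * k] to more than [2 * m i.+1 * k], which puts the clique among the
    candidates of round [i.+1] with few of its pairs yet examined. The
    assumption on [m l] guarantees that such a round exists, because after the
    last round all ['C(k, 2)] pairs have been probed. *)
Lemma card_large_answer l M k (m : nat -> nat) :
  (forall G, num_probes A l G <= M) ->
  (forall G, clique G (answer A l G)) ->
  2 * m l * k < 'C(k, 2) ->
  #|[set G : graph n | k <= #|answer A l G|]| * 2 ^ 'C(k, 2) <=
  \sum_(i < l) M ^ m i.+1 * n ^ (k - 2 * m i.+1) * 2 ^ (2 * m i * k)
               * 2 ^ #|vpair n|.
Proof.
move=> probesM cl mlk.
pose B (i : nat) := [set G : graph n |
  [exists C in matched_sets k (m i.+1) (probed i.+1 G),
    (pairs C \subset G) &&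
    ('C(k, 2) - 2 * m i * k <= #|pairs C :\: probed i G|)]].
have BU : [set G : graph n | k <= #|answer A l G|] \subset \bigcup_(i < l) B i.
  apply/subsetP => G; rewrite inE => kA.
  have : 0 < #|[set D : {set 'I_n} | D \subset answer A l G & #|D| == k]|.
    by rewrite cards_draws bin_gt0.
  case/card_gt0P => C; rewrite inE => /andP[CA /eqP Ck].
  have pCA : pairs C \subset pairs (answer A l G).
    apply/subsetP => e; rewrite !inE.
    by move=> /andP[/(subsetP CA) -> /(subsetP CA) ->].
  have CG : pairs C \subset G.
    by apply: subset_trans pCA _; rewrite -clique_pairs.
  have CP : pairs C \subset probed l G.
    exact: subset_trans pCA (pairs_answer_probed cl G).
  have pk : 'C(k, 2) <= #|pairs C| by rewrite -{1}Ck card_pairs.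
  have [i il /andP[sparse dense]] : exists2 i, i < l &
      (#|probed i G :&: pairs C| <= 2 * m i * k) &&
      ~~ (#|probed i.+1 G :&: pairs C| <= 2 * m i.+1 * k).
    apply: exists_crossing
      (fun i => #|probed i G :&: pairs C| <= 2 * m i * k) _ _ _.
      by rewrite /probed big_ord0 set0I cards0.
    by rewrite (setIidPr CP) -ltnNge; apply: leq_trans mlk pk.
  have [[s [sm sQ cs]]|] := matching_or_sparse (m i.+1)
      (subsetIr (probed i.+1 G) (pairs C)); last first.
    by rewrite Ck (negbTE dense).
  apply/bigcupP; exists (Ordinal il) => //; rewrite inE.
  apply/existsP; exists C; rewrite (matched_setsP Ck sm sQ cs) CG /=.
  by rewrite cardsD setIC; lia.
apply: (@leq_trans (\sum_(i < l) #|B i| * 2 ^ 'C(k, 2))).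
  rewrite -big_distrl leq_mul2r (leq_trans (subset_leq_card BU)) ?orbT //.
  exact: card_big_setU.
apply: leq_sum => i _.
apply: (@leq_trans (#|B i| * 2 ^ ('C(k, 2) - 2 * m i * k) * 2 ^ (2 * m i * k))).
  by rewrite -mulnA -expnD leq_mul2l leq_pexp2l ?orbT //; lia.
rewrite [X in _ <= X]mulnAC leq_mul2r; apply/orP; right.
apply: (card_exists_superset_adaptive
  (cand := fun G => matched_sets k (m i.+1) (probed i.+1 G))).
  by move=> G G' /probedS_eq ->.
move=> G; apply: card_matched_sets; apply: leq_trans (probesM G).
exact: card_probed.
Qed.

End Rounds.

Local Open Scope classical_set_scope.
Local Open Scope ring_scope.

(** * Asymptotics *)

Lemma natr_bin2 (R : realType) k : ('C(k, 2)%:R : R) = k%:R * (k%:R - 1) / 2.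
Proof.
case: k => [|k]; first by rewrite mul0r mul0r.
have : (2 * 'C(k.+1, 2) = k.+1 * k)%N.
  by have := mul_bin_diag k.+1 1; rewrite /= bin1 => ->.
move/(congr1 (fun x : nat => x%:R : R)); rewrite !natrM -[k.+1%:R]natr1 => h.
by apply: (mulfI (_ : 2 != 0 :> R)); rewrite ?pnatr_eq0 // h; field.
Qed.

Lemma powR2_log2 (R : realType) n : (0 < n)%N -> 2 `^ log2 (n%:R : R) = n%:R.
Proof.
move=> n0; have ln2 : ln (2 : R) != 0 by rewrite gt_eqF // ln_gt0 // ltr1n.
by rewrite /powR pnatr_eq0 /= /log2 mulfVK // lnK // posrE ltr0n.
Qed.

Lemma near_log2_ge (R : realType) (x : R) :
  (\forall n \near \oo, x <= log2 (n%:R : R)).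
Proof.
have ln2 : 0 < ln (2 : R) by rewrite ln_gt0 // ltr1n.
near=> n; rewrite /log2 ler_pdivlMr // -[leLHS]expRK ler_ln ?posrE ?expR_gt0 //.
- by near: n; exact: nbhs_infty_ger.
- by rewrite ltr0n; near: n; exact: nbhs_infty_gt.
Unshelve. all: by end_near.
Qed.

Lemma gnp_prob_half (R : realType) n (S : {set graph n}) :
  gnp_prob (2^-1 : R) S = #|S|%:R / 2 ^+ #|vpair n|.
Proof.
rewrite /gnp_prob (eq_bigr (fun=> (2^-1 : R) ^+ #|vpair n|)).
  by rewrite sumr_const exprVn -[LHS]mulr_natl.
move=> G _; rewrite /gnp -prodr_const; apply: eq_bigr => e _.
by case: ifP => // _; field.
Qed.

(** The left side is the base-2 logarithm of the bound for one round, with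
    [L] = log n, [eta] = 2 - delta, [m] the matching size and [m'] the threshold
    of the preceding round. Put t = eta c. With k close to 2L, the matching
    gains t k L; of this gain, the pairs already examined cost t k L / 2 and the
    excess of k L over k^2 / 2 costs at most t k L / 4. The remaining quarter
    dominates the rounding errors, which are at most 3k. *)
Lemma round_exponent_le (R : realType) (eta c eps L k m m' : R) :
  0 < eta <= 1 -> 0 < c -> c <= 1 -> eps <= eta * c / 2 -> 1 <= L ->
  (2 - eps) * L <= k -> k <= 2 * L + 1 ->
  c * k - 1 <= m -> m' <= eta * c / 8 * k ->
  (2 - eta) * L * m + L * (k - 2 * m) + 2 * m' * k - k * (k - 1) / 2
    <= - (k * (L * (eta * c) / 4 - 3)).
Proof.
move=> /andP[eta0 eta1] c0 c1 epsc L1 kL kL' mk m'k.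
set t := eta * c in epsc m'k *.
have t0 : 0 < t by rewrite mulr_gt0.
have t1 : t <= 1 by rewrite /t; nra.
have Lk : L <= k by nra.
have h1 : eta * L * (c * k - 1) <= eta * L * m by rewrite ler_wpM2l //; nra.
have h2 : m' * k <= t / 8 * k * k by rewrite ler_wpM2r //; nra.
have h3 : k * ((2 - eps) * L) <= k * k by rewrite ler_wpM2l //; nra.
have h4 : t * k * k <= t * k * (2 * L + 1) by rewrite ler_wpM2l //; nra.
have h5 : eps * (k * L) <= t / 2 * (k * L) by rewrite ler_wpM2r //; nra.
have h6 : eta * L <= L by nra.
have h7 : t * k <= k by nra.
have h1' : eta * L * (c * k - 1) = t * (k * L) - eta * L by rewrite /t; ring.
lra.
Qed.

Lemma round_term_le (R : realType) (eta L : R) n M k m m' :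
  n%:R = 2 `^ L -> M%:R <= 2 `^ ((2 - eta) * L) -> (2 * m <= k)%N ->
  (M ^ m * n ^ (k - 2 * m) * 2 ^ (2 * m' * k))%:R / 2 ^+ 'C(k, 2) <=
  2 `^ ((2 - eta) * L * m%:R + L * (k%:R - 2 * m%:R) + 2 * m'%:R * k%:R
        - k%:R * (k%:R - 1) / 2) :> R.
Proof.
move=> nL ML mk; have two0 : 2 != 0 :> R by rewrite pnatr_eq0.
have powD (x y : R) : 2 `^ (x + y) = 2 `^ x * 2 `^ y.
  by rewrite powRD // two0 implybT.
rewrite powD powRN -natr_bin2 powR_mulrn // ler_wpM2r ?invr_ge0 ?exprn_ge0 //.
rewrite !powD !natrM !natrX.
apply: ler_pM; rewrite ?mulr_ge0 ?exprn_ge0 //.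
apply: ler_pM; rewrite ?mulr_ge0 ?exprn_ge0 //.
- by rewrite powRrM powR_mulrn ?powR_ge0 // lerXn2r ?nnegrE ?powR_ge0.
- by rewrite powRrM -natrM -natrB // powR_mulrn ?powR_ge0 // nL.
- by rewrite -!natrM powR_mulrn.
Qed.

(** The thresholds are [c i * k] with [c l = 1/8] and
    [c i = (eta / 8) * c i.+1], so [c 1] is the smallest threshold constant used
    for a matching and dictates [eps = eta * c 1 / 2]. Adding 1 to the clique
    size leaves room for an integer k above [(2 - eps) * log2 n]. *)
Lemma large_cliques_rare (R : realType) (delta : R) (l : nat) :
  1 <= delta < 2 -> (0 < l)%N ->
  exists2 eps : R, 0 < eps & \forall n \near \oo, forall A : algorithm n,
    (forall G : graph n, (num_probes A l G)%:R <= n%:R `^ delta) ->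
    (forall G : graph n, clique G (answer A l G)) ->
    gnp_prob (2^-1 : R)
      [set G : graph n |
        (2 - eps) * log2 n%:R + 1 <= #|answer A l G|%:R :> R]%SET < 2^-1.
Proof.
move=> /andP[delta1 delta2] l0; set eta := 2 - delta.
have eta0 : 0 < eta by rewrite subr_gt0.
have eta1 : eta <= 1 by rewrite /eta; lra.
pose c (i : nat) : R := 8^-1 * (eta / 8) ^+ (l - i).
have c_gt0 i : 0 < c i by rewrite mulr_gt0 ?invr_gt0 // exprn_gt0 // divr_gt0.
have c_le i : c i <= 8^-1.
  rewrite /c ler_piMr ?invr_ge0 // exprn_ile1 //; lra.
have cS i : (i < l)%N -> eta * c i.+1 / 8 = c i.
  by move=> il; rewrite /c -(subnSK il) exprS; ring.
have c1_le i : c 1%N <= c i.+1.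
  rewrite /c ler_wpM2l ?invr_ge0 // ler_wiXn2l //; try lra.
  by rewrite leq_sub2l.
set t := eta * c 1%N.
have t0 : 0 < t by rewrite mulr_gt0.
have t1 : t <= 1 / 8 by rewrite /t; have := c_le 1%N; have := c_gt0 1%N; nra.
exists (t / 2); first by rewrite divr_gt0.
near=> n => A probesM cl.
set L := log2 (n%:R : R).
have n0 : (0 < n)%N by near: n; exact: nbhs_infty_gt.
have nL : n%:R = 2 `^ L :> R by rewrite powR2_log2.
(* This makes the exponent of every round at most - (l + 1), so the l rounds
   contribute at most l / 2^(l+1) < 1/2. *)
have Lbig : (16 + 4 * l%:R) / t <= L.
  by rewrite /L; near: n; exact: near_log2_ge.
have tL : 16 + 4 * l%:R <= L * t by rewrite -ler_pdivrMr.
have L16 : 16 <= L by have := ler0n R l; nra.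
pose k := (Num.truncn ((2 - t / 2) * L)).+1.
have /andP[kl ku] : (2 - t / 2) * L <= k%:R <= 2 * L + 1.
  have /truncn_itv /andP[lo hi] : 0 <= (2 - t / 2) * L by nra.
  by rewrite ltW //= /k -natr1; nra.
have k3 : (3 <= k)%N by rewrite -(ler_nat R); nra.
pose m i := Num.truncn (c i * k%:R).
have m_itv i : (m i)%:R <= c i * k%:R < (m i).+1%:R.
  by apply: truncn_itv; rewrite mulr_ge0 // ltW.
have m8 i : (8 * m i <= k)%N.
  have /andP[lo _] := m_itv i; rewrite -(ler_nat R) natrM.
  have := c_le i; have := ler0n R k; nra.
pose M := Num.truncn (n%:R `^ delta : R).
have probesM' G : (num_probes A l G <= M)%N.
  by rewrite truncn_ge_nat ?powR_ge0.
have ML : M%:R <= 2 `^ ((2 - eta) * L) :> R.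
  rewrite /eta opprB addrC subrK mulrC powRrM -nL.
  by rewrite truncn_le powR_ge0.
have mlk : (2 * m l * k < 'C(k, 2))%N.
  have := m8 l; have := mul_bin_diag k 1; rewrite /= bin1 => h1 h2.
  by rewrite -(ltn_pmul2l (isT : 0 < 2)%N) -h1; nia.
have count := card_large_answer probesM' cl mlk.
set S := (X in gnp_prob _ X).
set S' := (X in (#|pred_of_set X| * _)%N) in count.
have SS' : (#|S| <= #|S'|)%N.
  apply/subset_leq_card/subsetP => G; rewrite !inE => hG.
  rewrite -(ltr_nat R); apply: le_lt_trans (_ : _ <= (2 - t / 2) * L) _.
    by rewrite truncn_le; nra.
  by apply: lt_le_trans hG; rewrite ltrDl.
rewrite gnp_prob_half ltr_pdivrMr ?exprn_gt0 //.
apply: le_lt_trans (_ : #|S'|%:R < _); first by rewrite ler_nat.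
rewrite -(ltr_pM2r (_ : 0 < 2 ^+ 'C(k, 2) :> R)) ?exprn_gt0 //.
rewrite -natrX -natrM; apply: le_lt_trans (_ : _%:R < _).
  by rewrite ler_nat; exact: count.
rewrite natr_sum natrX.
apply: (@le_lt_trans _ _ (\sum_(i < l)
    2 ^- l.+1 * (2 ^+ #|vpair n| * 2 ^+ 'C(k, 2) : R))).
  apply: ler_sum => i _; rewrite natrM natrX.
  rewrite [2 ^+ #|_| * _]mulrC mulrA ler_wpM2r ?exprn_ge0 //.
  rewrite -ler_pdivrMr ?exprn_gt0 //; have mi := m8 i.+1.
  apply: le_trans (round_term_le _ nL ML _) _; first by lia.
  rewrite -powR_invn // ler_powR ?ler1n //.
  apply: le_trans
    (round_exponent_le (c := c i.+1) (eps := t / 2) _ _ _ _ _ kl ku _ _) _.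
  - by rewrite eta0.
  - by [].
  - by have := c_le i.+1; lra.
  - by rewrite ler_pM2r ?invr_gt0 // ler_wpM2l // ltW.
  - by lra.
  - by have /andP[_] := m_itv i.+1; rewrite -natr1; lra.
  - by rewrite cS //; have /andP[] := m_itv i.
  rewrite lerN2 -natr1; have h1 : t <= eta * c i.+1 by rewrite ler_wpM2l // ltW.
  have k1 : 1 <= k%:R :> R by rewrite ler1n.
  have : 1 + l%:R <= L * (eta * c i.+1) / 4 - 3 by nra.
  have := ler0n R l; nra.
rewrite sumr_const card_ord -[ltLHS]mulr_natl exprS invfM !mulrA.
rewrite ltr_pM2r ?exprn_gt0 // ltr_pM2r ?exprn_gt0 //.
rewrite -mulrA mulrCA gtr_pMr ?invr_gt0 // ltr_pdivrMr ?exprn_gt0 // mul1r.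
by rewrite -natrX ltr_nat ltn_expl.
Unshelve. all: by end_near.
Qed.

Theorem theorem2 (R : realType) (delta : R) (l : nat)
  (hdelta : (delta < 2)%R) (hl : (0 < l)%N) :
  (alpha_star delta l < 2%:E)%E.
Proof.
(* A larger budget only helps, and delta at least 1 gives 2 - delta <= 1. *)
pose delta' := Num.max delta 1.
have delta'_itv : 1 <= delta' < 2.
  by rewrite /delta' le_max lexx orbT gt_max hdelta ltr1n.
have [eps eps0 rare] := large_cliques_rare delta'_itv hl.
apply: (@le_lt_trans _ _ (2 - eps)%:E); last by rewrite lte_fin; lra.
apply: ge_ereal_sup => _ [alpha [A good] <-]; rewrite lee_fin leNgt.
apply/negP => alpha_gt.
suff /filter_ex[n []] : \forall n \near \oo, False by [].
apply: filter_app good; apply: filter_app rare.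
near=> n => rare_n [probes cl half].
have n0 : (0 < n)%N by near: n; exact: nbhs_infty_gt.
(* alpha log n exceeds (2 - eps) log n by at least 1 for large n. *)
have Lbig : (alpha - (2 - eps))^-1 <= log2 (n%:R : R).
  by near: n; exact: near_log2_ge.
suff : (2^-1 : R) < 2^-1 by rewrite ltxx.
apply: le_lt_trans half (le_lt_trans _ (rare_n (A n) _ cl)).
- rewrite !gnp_prob_half ler_wpM2r ?invr_ge0 ?exprn_ge0 // ler_nat.
  apply/subset_leq_card/subsetP => G; rewrite !inE; apply: le_trans.
  rewrite -[leRHS](subrK ((2 - eps) * log2 n%:R)) -mulrBl addrC lerD2r.
  by rewrite -ler_pdivrMl ?subr_gt0 // mulr1.
- move=> G; apply: le_trans (probes G) _.
  by rewrite ler_powR ?ler1n // /delta' le_max lexx.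
Unshelve. all: by end_near.
Qed.
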